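(* Let $H$ be any (finite, simple) graph containing $n$ vertices and $m$ edges, with average vertex degree $d_{av}$, maximum vertex degree $\Delta$ and maximum average degree $h_{av}$. Then the chromatic number of $H$ satisfies $$\chi(H)\le 2\max(1,h_{av})\cdot\log\left(\frac{ne}{\max(1,h_{av})}\right),$$ where $h_{av}$ satisfies $d_{av}\le h_{av}\le\min\left(\sqrt{2m},\,6(m\Delta)^{1/3}\right)$.
   Context: The maximum average degree of $H$ is $h_{av}=h_{av}(H):=\max_{\Gamma}d_{av}(\Gamma)$, where the maximum is over all subgraphs $\Gamma\subseteq H$ and $d_{av}(\Gamma)$ is the average vertex degree of $\Gamma$; $d_{av}=d_{av}(H)$. The logarithm is natural and $e$ is its base. *)

(* Defs.v *)
From HB Require Import structures.
From mathcomp Require Import all_boot all_order all_algebra.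
From mathcomp Require Import all_classical all_reals all_analysis.

Set Implicit Arguments.
Unset Strict Implicit.
Unset Printing Implicit Defensive.

Import Order.TTheory GRing.Theory Num.Theory.
Local Open Scope ring_scope.

(* The vertex set is a subset of the ambient finite type [T], so that a graph
   and all of its subgraphs live in the single type [sgraph T]. *)
Definition is_sgraph (T : finType) (p : {set T} * {set {set T}}) : bool :=
  [forall a in p.2, (#|a| == 2)%N && (a \subset p.1)].

Record sgraph (T : finType) := SGraph {
  sgraph_val : {set T} * {set {set T}};
  sgraphP : is_sgraph sgraph_val }.

HB.instance Definition _ (T : finType) := [isSub for @sgraph_val T].
HB.instance Definition _ (T : finType) := [Finite of sgraph T by <:].

Definition vertices (T : finType) (G : sgraph T) : {set T} := (sgraph_val G).1.
Definition edges (T : finType) (G : sgraph T) : {set {set T}} :=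
  (sgraph_val G).2.

Definition adj (T : finType) (G : sgraph T) : rel T :=
  [rel u v | [set u; v] \in edges G].

Definition degree (T : finType) (G : sgraph T) (v : T) : nat :=
  #|[set u | adj G v u]|.

Definition max_degree (T : finType) (G : sgraph T) : nat :=
  \max_(v in vertices G) degree G v.

Definition avg_degree (R : realType) (T : finType) (G : sgraph T) : R :=
  (\sum_(v in vertices G) degree G v)%N%:R / #|vertices G|%:R.

Definition subgraph (T : finType) (G H : sgraph T) : bool :=
  (vertices G \subset vertices H) && (edges G \subset edges H).

(* Subgraphs need not be induced.  The default value 0 only matters when [H]
   has no vertex, since average degrees are nonnegative. *)
Definition max_avg_degree (R : realType) (T : finType) (H : sgraph T) : R :=
  \big[Num.max/0]_(G : sgraph T | subgraph G H && (vertices G != finset.set0))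
    avg_degree R G.

(* Only the vertices of [G] are coloured, not all of [T]; in particular the
   graph without vertices is 0-colourable. *)
Definition colorable (T : finType) (G : sgraph T) (k : nat) : bool :=
  [exists c : {ffun {v : T | v \in vertices G} -> 'I_k},
     [forall u, [forall v, adj G (val u) (val v) ==> (c u != c v)]]].

Lemma colorable_ex (T : finType) (G : sgraph T) : exists k, colorable G k.
Proof.
exists #|{: {v : T | v \in vertices G}}|.
apply/existsP; exists [ffun v => enum_rank v].
apply/forallP => u; apply/forallP => v; apply/implyP => uv.
rewrite !ffunE (inj_eq enum_rank_inj); apply: contraTneq uv => ->.
rewrite /adj /= finset.setUid; apply/negP => /(forall_inP (sgraphP G)).
by rewrite cards1.
Qed.

Definition chromatic_number (T : finType) (G : sgraph T) : nat :=
  ex_minn (colorable_ex G).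

(* Main.v *)
(* Every subgraph of H has a vertex whose degree is at most the average degree
   of that subgraph, hence at most h_av; removing such vertices one after the
   other and colouring greedily in the reverse order gives chi <= h_av + 1,
   which is at most 2 * max(1, h_av).  The logarithm is at least 1 because
   max(1, h_av) <= n.  For the bounds on h_av, the average degree a of a
   subgraph on k vertices satisfies a <= k, a <= Delta and a * k <= 2 * m,
   so that a ^ 2 <= 2 * m and a ^ 3 <= 2 * m * Delta. *)
Require Import Defs.
From HB Require Import structures.
From mathcomp Require Import all_boot all_order all_algebra.
From mathcomp Require Import all_classical all_reals all_analysis.
From mathcomp Require Import fintype finset lra.
Import Order.TTheory GRing.Theory Num.Theory.
Local Open Scope ring_scope.

Set Implicit Arguments.
Unset Strict Implicit.
Unset Printing Implicit Defensive.

(** * Incidences between vertices and edges *)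

Lemma edge_card2 (T : finType) (G : sgraph T) (a : {set T}) :
  a \in edges G -> #|a| = 2%N.
Proof. by move=> aE; have /andP[/eqP] := forall_inP (sgraphP G) _ aE. Qed.

Lemma edge_sub_vertices (T : finType) (G : sgraph T) (a : {set T}) :
  a \in edges G -> a \subset vertices G.
Proof. by move=> aE; have /andP[] := forall_inP (sgraphP G) _ aE. Qed.

Lemma adj_sym (T : finType) (G : sgraph T) : symmetric (adj G).
Proof. by move=> u v; rewrite /adj /= setUC. Qed.

Lemma adj_irrefl (T : finType) (G : sgraph T) : irreflexive (adj G).
Proof.
move=> v; apply/negP; rewrite /adj /= setUid => /edge_card2.
by rewrite cards1.
Qed.

Lemma adj_vertexr (T : finType) (G : sgraph T) (u v : T) :
  adj G u v -> v \in vertices G.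
Proof. by move/edge_sub_vertices/subsetP; apply; rewrite !inE eqxx orbT. Qed.

Lemma degree_le_order (T : finType) (G : sgraph T) (v : T) :
  (degree G v <= #|vertices G|)%N.
Proof.
by apply/subset_leq_card/subsetP => u; rewrite inE => /adj_vertexr.
Qed.

Lemma degree_subgraph (T : finType) (G H : sgraph T) (v : T) :
  subgraph G H -> (degree G v <= degree H v)%N.
Proof.
case/andP=> _ /subsetP EGH; apply/subset_leq_card/subsetP => u.
by rewrite !inE; apply: EGH.
Qed.

(** The map [u |-> [set v; u]] sends neighbours of [v] to edges through [v]. It is injective on
    neighbours: [[set v; u] = [set v; w]] forces [u = w] or [u = v], and the latter would be a
    loop. *)
Lemma degree_le_incident (T : finType) (G : sgraph T) (v : T) :
  (degree G v <= #|[set a in edges G | v \in a]|)%N.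
Proof.
rewrite /degree -(@card_in_imset _ _ (fun u => [set v; u])); last first.
  move=> u w; rewrite !inE => vu _ /setP/(_ u).
  rewrite !inE eqxx orbT => /esym/orP[/eqP uv|/eqP //].
  by move: vu; rewrite uv adj_irrefl.
apply/subset_leq_card/subsetP => a /imsetP[u].
by rewrite !inE => vu ->; rewrite !inE eqxx andbT.
Qed.

(** Double counting of the pairs [(v, a)] with [v \in a]: after the exchange of sums each edge
    contributes 2. *)
Lemma sum_degree_le (T : finType) (G : sgraph T) :
  (\sum_(v in vertices G) degree G v <= 2 * #|edges G|)%N.
Proof.
apply: (@leq_trans (\sum_(v : T) \sum_(a in edges G) (v \in a))%N).
  rewrite big_mkcond /=; apply: leq_sum => v _; case: ifP => // _.
  apply: leq_trans (degree_le_incident G v) _.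
  rewrite -sum1_card big_mkcond [leqRHS]big_mkcond; apply: leq_sum => a _.
  by rewrite inE; case: (a \in edges G).
rewrite exchange_big /= (eq_bigr (fun=> 2%N)) ?sum_nat_const 1?mulnC //.
move=> a /edge_card2 <-; rewrite -sum1_card [RHS]big_mkcond.
by apply: eq_bigr => v _; case: (v \in a).
Qed.

(** * Induced subgraphs and greedy colouring *)

Lemma is_sgraph_induced (T : finType) (G : sgraph T) (A : {set T}) :
  is_sgraph (A, [set a in edges G | a \subset A]).
Proof.
by apply/forall_inP => a; rewrite inE => /andP[/edge_card2 -> ->].
Qed.

Definition induced (T : finType) (G : sgraph T) (A : {set T}) : sgraph T :=
  SGraph (is_sgraph_induced G A).

Lemma induced_subgraph (T : finType) (G : sgraph T) (A : {set T}) :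
  A \subset vertices G -> subgraph (induced G A) G.
Proof.
by move=> AV; rewrite /subgraph AV; apply/subsetP => a; rewrite inE => /andP[].
Qed.

Lemma degree_induced (T : finType) (G : sgraph T) (A : {set T}) (v : T) :
  v \in A -> degree (induced G A) v = #|[set u in A | adj G v u]|.
Proof.
move=> vA; apply: eq_card => u.
by rewrite !inE /adj /= inE subUset !sub1set vA andbC.
Qed.

(** For a graph without vertices this makes the chromatic number 0. *)
Lemma colorable_order (T : finType) (G : sgraph T) : colorable G #|vertices G|.
Proof.
have card_le : (#|{: {v : T | v \in vertices G}}| <= #|vertices G|)%N.
  by rewrite card_sig.
apply/existsP; exists [ffun v => widen_ord card_le (enum_rank v)].
apply/forallP => u; apply/forallP => v; apply/implyP => uv.
rewrite !ffunE; apply: contraTneq uv => /(congr1 val) /= /val_inj/enum_rank_inj.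
by move=> ->; rewrite adj_irrefl.
Qed.

Lemma chromatic_number_le (T : finType) (G : sgraph T) (k : nat) :
  colorable G k -> (chromatic_number G <= k)%N.
Proof. by rewrite /chromatic_number; case: ex_minnP => c _; apply. Qed.

Lemma degenerate_colorable (T : finType) (G : sgraph T) (d : nat) :
  (forall A : {set T}, A \subset vertices G -> A != finset.set0 ->
     exists2 v, v \in A & (#|[set u in A | adj G v u]| <= d)%N) ->
  colorable G d.+1.
Proof.
move=> degen.
(* A colouring defined on all of [T] keeps its type when the set it must be proper on shrinks during
   the induction. *)
suff [c cP] : exists c : T -> 'I_d.+1,
    {in vertices G &, forall u v, adj G u v -> c u != c v}.
  apply/existsP; exists [ffun v => c (val v)].
  apply/forallP => u; apply/forallP => v; apply/implyP => uv.
  by rewrite !ffunE cP ?(valP u) ?(valP v).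
have [k] := ubnP #|vertices G|; move: (subxx (vertices G)).
(* Strong induction on the size of [A]; the occurrence left in place is the upper bound in
   [A \subset vertices G]. *)
move: {1 3 4}(vertices G) => A; elim: k A => // k IH A AV.
rewrite ltnS => Ak.
have [->|A0] := eqVneq A finset.set0; first by exists (fun=> ord0) => u v; rewrite inE.
have [v vA vd] := degen A AV A0.
have AvV : A :\ v \subset vertices G := subset_trans (subD1set A v) AV.
have Avk : (#|A :\ v| < k)%N by move: Ak; rewrite (cardsD1 v) vA.
have [c cP] := IH _ AvV Avk.
pose used := [set c u | u in [set u in A | adj G v u]].
(* If all [d.+1] colours were used, [v] would have more than [d] neighbours in [A]. *)
have [x xP] : exists x, x \notin used.
  apply/existsP; rewrite -negb_forall; apply: contraL vd => /forallP all_used.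
  rewrite -ltnNge -[d.+1]card_ord.
  apply: leq_trans (leq_imset_card c _); apply/subset_leq_card/subsetP => x _.
  exact: all_used.
have xN u : u \in A -> adj G v u -> c u != x.
  move=> uA vu; apply: contraNneq xP => <-; apply/imsetP; exists u => //.
  by rewrite inE uA.
exists (fun u => if u == v then x else c u) => u w uA wA uw.
case: (eqVneq u v) uw => [->|uv]; case: (eqVneq w v) => [->|wv] uw.
- by rewrite adj_irrefl in uw.
- by rewrite eq_sym xN.
- by rewrite xN // adj_sym.
- by apply: cP; rewrite // !inE ?uv ?wv.
Qed.

(** * Average degree of a single graph *)

Section AverageDegree.
Variables (R : realType) (T : finType).
Implicit Types G H : sgraph T.

Lemma avg_degree_ge0 G : 0 <= avg_degree R G.
Proof. by rewrite divr_ge0. Qed.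

Lemma avg_degree_le G (k : nat) :
  (forall v, v \in vertices G -> (degree G v <= k)%N) ->
  avg_degree R G <= k%:R.
Proof.
move=> degk; rewrite /avg_degree.
(* Without vertices the average is 0, since [0^-1 = 0]. *)
have [->|V0] := posnP #|vertices G|; first by rewrite invr0 mulr0.
by rewrite ler_pdivrMr ?ltr0n // -natrM ler_nat mulnC -sum_nat_const leq_sum.
Qed.

Lemma avg_degree_le_order G : avg_degree R G <= #|vertices G|%:R.
Proof. by apply: avg_degree_le => v _; apply: degree_le_order. Qed.

Lemma avg_degree_order G :
  avg_degree R G * #|vertices G|%:R <= 2 * #|edges G|%:R.
Proof.
have [->|V0] := posnP #|vertices G|; first by rewrite mulr0 mulr_ge0.
by rewrite divfK ?pnatr_eq0 -?lt0n // -natrM ler_nat sum_degree_le.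
Qed.

Lemma avg_degree_sqr_le G : avg_degree R G ^+ 2 <= 2 * #|edges G|%:R.
Proof.
apply: le_trans (avg_degree_order G); rewrite expr2.
by rewrite ler_wpM2l ?avg_degree_ge0 ?avg_degree_le_order.
Qed.

(** If every degree exceeded the average, summing over the vertices would put the average strictly
    above itself; strictness uses that a vertex exists. *)
Lemma exists_degree_le_avg G :
  vertices G != finset.set0 ->
  exists2 v, v \in vertices G & (degree G v)%:R <= avg_degree R G.
Proof.
move=> V0; apply/exists_inP; apply: contraTT isT.
rewrite negb_exists_in => /forall_inP degs.
suff: avg_degree R G < avg_degree R G by rewrite ltxx.
have k0 : (0 : R) < #|vertices G|%:R by rewrite ltr0n card_gt0.
rewrite {2}/avg_degree ltr_pdivlMr // natr_sum mulr_natr -sumr_const.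
apply: ltr_sum => [|v vG]; last by rewrite ltNge degs.
by case/set0Pn: V0 => v vG; apply/hasP; exists v; rewrite ?mem_index_enum.
Qed.

(** * Maximum average degree *)

Lemma avg_degree_le_max H G : subgraph G H -> vertices G != finset.set0 ->
  avg_degree R G <= max_avg_degree R H.
Proof.
by move=> GH G0; rewrite /max_avg_degree; apply: le_bigmax_cond; rewrite GH.
Qed.

Lemma max_avg_degree_ge0 H : 0 <= max_avg_degree R H.
Proof. exact: bigmax_ge_id. Qed.

Lemma avg_degree_le_max_avg H : avg_degree R H <= max_avg_degree R H.
Proof.
(* A graph without vertices does not enter its own maximum, but its average degree is 0, the default
   value. *)
have [V0|V0] := eqVneq (vertices H) finset.set0.
  by rewrite /avg_degree V0 cards0 invr0 mulr0 max_avg_degree_ge0.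
by apply: avg_degree_le_max; rewrite // /subgraph !subxx.
Qed.

Lemma max_avg_degree_le H (b : R) : 0 <= b ->
  (forall G, subgraph G H -> avg_degree R G <= b) -> max_avg_degree R H <= b.
Proof. by move=> b0 bP; apply: bigmax_le => // G /andP[/bP]. Qed.

Lemma max_avg_degree_le_order H : max_avg_degree R H <= #|vertices H|%:R.
Proof.
apply: max_avg_degree_le => // G /andP[VGH _].
by apply: le_trans (avg_degree_le_order G) _; rewrite ler_nat subset_leq_card.
Qed.

Lemma subgraph_avg_degree_sqr_le H G : subgraph G H ->
  avg_degree R G ^+ 2 <= 2 * #|edges H|%:R.
Proof.
case/andP=> _ EGH; apply: le_trans (avg_degree_sqr_le G) _.
by rewrite ler_wpM2l // ler_nat subset_leq_card.
Qed.

Lemma max_avg_degree_le_sqrt H :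
  max_avg_degree R H <= Num.sqrt (2 * #|edges H|%:R).
Proof.
apply: max_avg_degree_le => [|G /subgraph_avg_degree_sqr_le GH].
  exact: sqrtr_ge0.
by rewrite -(ger0_norm (avg_degree_ge0 G)) -sqrtr_sqr ler_wsqrtr.
Qed.

Lemma max_avg_degree_le_cbrt H :
  max_avg_degree R H <=
    6 * (#|edges H|%:R * (max_degree H)%:R) `^ (3%:R^-1).
Proof.
apply: max_avg_degree_le => [|G GH]; first by rewrite mulr_ge0 ?powR_ge0.
rewrite -(@ler_pXn2r _ 3%N) ?nnegrE ?avg_degree_ge0 ?mulr_ge0 ?powR_ge0 //.
have cbrtK (x : R) : 0 <= x -> (x `^ 3%:R^-1) ^+ 3 = x.
  by move=> x0; rewrite -powR_mulrn ?powR_ge0 // -powRrM mulVf ?powRr1.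
rewrite [leRHS]exprMn cbrtK ?mulr_ge0 // exprSr.
have a_le : avg_degree R G <= (max_degree H)%:R.
  apply: avg_degree_le => v vG; apply: leq_trans (degree_subgraph v GH) _.
  by apply: leq_bigmax_cond; case/andP: GH => /subsetP VGH _; apply: VGH.
apply: le_trans (ler_pM _ _ (subgraph_avg_degree_sqr_le GH) a_le) _.
- exact: sqr_ge0.
- exact: avg_degree_ge0.
(* After cubing, the constant 2 only has to be at most [6 ^ 3]. *)
- by rewrite -mulrA ler_wpM2r ?mulr_ge0 // -natrX ler_nat.
Qed.

Lemma chromatic_number_le_max_avg H :
  (chromatic_number H)%:R <= max_avg_degree R H + 1.
Proof.
have h0 := max_avg_degree_ge0 H.
(* Degrees are integers, so a degree at most [h_av] is at most its integer part, which serves as the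
   degeneracy. *)
apply: (@le_trans _ _ (Num.truncn (max_avg_degree R H)).+1%:R); last first.
  by rewrite -natr1 lerD2r -truncn_ge_nat.
rewrite ler_nat; apply/chromatic_number_le/degenerate_colorable => A AV A0.
have [v vA deg_v] := @exists_degree_le_avg (induced H A) A0.
exists v; first exact: vA.
rewrite -degree_induced // truncn_ge_nat //; apply: le_trans deg_v _.
by apply: avg_degree_le_max; rewrite ?induced_subgraph.
Qed.

End AverageDegree.

Theorem lemma4 (R : realType) (T : finType) (H : sgraph T) (n m Delta : nat)
    (d_av h_av : R)
    (n_def : n = #|vertices H|)
    (m_def : m = #|edges H|)
    (Delta_def : Delta = max_degree H)
    (d_av_def : d_av = avg_degree R H)
    (h_av_def : h_av = max_avg_degree R H) :
  (chromatic_number H)%:R <=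
      2 * Num.max 1 h_av * ln (n%:R * expR 1 / Num.max 1 h_av)
  /\ d_av <= h_av <=
      Num.min (Num.sqrt (2 * m%:R)) (6 * (m%:R * Delta%:R) `^ (3%:R^-1)).
Proof.
subst; split; last first.
  by rewrite avg_degree_le_max_avg le_min max_avg_degree_le_sqrt
             max_avg_degree_le_cbrt.
set h := max_avg_degree R H; set M := Num.max 1 h.
(* When [n = 0] the right-hand side is 0 because [ln 0 = 0], and the chromatic number is 0 too. *)
have [V0|V0] := posnP #|vertices H|.
  have := chromatic_number_le (colorable_order H).
  by rewrite V0 leqn0 => /eqP ->; rewrite !mul0r ln0 // mulr0.
have M1 : 1 <= M by rewrite le_max lexx.
have M0 : 0 < M := lt_le_trans ltr01 M1.
have hM : h <= M by rewrite le_max lexx orbT.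
have Mn : M <= #|vertices H|%:R by rewrite ge_max ler1n V0 max_avg_degree_le_order.
apply: (@le_trans _ _ (2 * M)).
  by apply: le_trans (chromatic_number_le_max_avg R H) _; rewrite -/h; lra.
(* It remains to see that the logarithm is at least 1; writing 1 as [ln (expR 1)] reduces this to
   [Mn]. *)
rewrite ler_peMr ?mulr_ge0 ?(ltW M0) // -[leLHS](expRK 1).
rewrite ler_ln ?posrE ?divr_gt0 ?mulr_gt0 ?expR_gt0 ?ltr0n //.
by rewrite ler_pdivlMr // mulrC ler_wpM2r ?expR_ge0.
Qed.
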